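(* Let $r>0$. The $3$-invariant surface in $\mathrm{Sol}_3$ generated by the Euclidean circle $$\alpha(s)=\left(r\sin\left(\tfrac{s}{r}\right),\,-r\cos\left(\tfrac{s}{r}\right),\,0\right),\qquad s\in\mathbb R,$$ that is, the surface $\psi(s,t)=\left(e^{-t}r\sin(s/r),\,-e^{t}r\cos(s/r),\,t\right)$, $s,t\in\mathbb R$, has zero Gauss curvature, $K=0$.
   Context: $\mathrm{Sol}_3$ is $\mathbb R^3$ with coordinates $(x,y,z)$ and the Riemannian metric $\langle\,,\rangle=e^{2z}dx^2+e^{-2z}dy^2+dz^2$. For $t\in\mathbb R$ the map $L_t(x,y,z)=(e^{-t}x,e^ty,z+t)$ is an isometry; a surface is called $3$-invariant if it is invariant under all $L_t$, $t\in\mathbb R$. The $3$-invariant surface generated by a regular curve $\alpha(s)=(x(s),y(s),0)$ in the plane $z=0$ is the immersed surface $\psi(s,t)=L_t(\alpha(s))$. The Gauss curvature $K$ is the intrinsic curvature of the metric induced by $\mathrm{Sol}_3$ on the surface (equivalently, the extrinsic curvature plus the sectional curvature of the tangent plane in $\mathrm{Sol}_3$). *)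

(* Defs.v *)
From Stdlib Require Import Reals.
From Coquelicot Require Import Coquelicot.
Open Scope R_scope.

(** * The Riemannian manifold Sol_3 *)

(* Both the points (x, y, z) of Sol_3 and the coordinates of a tangent vector
   in the frame (d/dx, d/dy, d/dz). *)
Definition R3 : Type := (R * R * R)%type.

Definition px (p : R3) : R := fst (fst p).
Definition py (p : R3) : R := snd (fst p).
Definition pz (p : R3) : R := snd p.

Definition sol_metric (p u v : R3) : R :=
  exp (2 * pz p) * px u * px v
  + exp (- (2 * pz p)) * py u * py v
  + pz u * pz v.

Definition sol_L (t : R) (p : R3) : R3 :=
  (exp (- t) * px p, exp t * py p, pz p + t).

(** * Parametrized surfaces *)

Inductive idx : Set := i1 | i2.

Definition sum2 (f : idx -> R) : R := f i1 + f i2.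

Definition pd (i : idx) (f : R -> R -> R) (s t : R) : R :=
  match i with
  | i1 => Derive (fun u => f u t) s
  | i2 => Derive (fun v => f s v) t
  end.

Definition surf_pd (i : idx) (psi : R -> R -> R3) (s t : R) : R3 :=
  (pd i (fun u v => px (psi u v)) s t,
   pd i (fun u v => py (psi u v)) s t,
   pd i (fun u v => pz (psi u v)) s t).

Definition smooth2 (f : R -> R -> R) : Prop :=
  forall (n : nat) (s t : R), ex_diff_n f n s t.

Definition immersed_surface (psi : R -> R -> R3) : Prop :=
  (smooth2 (fun s t => px (psi s t)) /\
   smooth2 (fun s t => py (psi s t)) /\
   smooth2 (fun s t => pz (psi s t))) /\
  (forall s t a b : R,
     a * px (surf_pd i1 psi s t) + b * px (surf_pd i2 psi s t) = 0 ->
     a * py (surf_pd i1 psi s t) + b * py (surf_pd i2 psi s t) = 0 ->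
     a * pz (surf_pd i1 psi s t) + b * pz (surf_pd i2 psi s t) = 0 ->
     a = 0 /\ b = 0).

(** * Intrinsic curvature of a Riemannian metric in two coordinates *)

Definition metric2 : Type := idx -> idx -> R -> R -> R.

Definition det_metric (g : metric2) (s t : R) : R :=
  g i1 i1 s t * g i2 i2 s t - g i1 i2 s t * g i2 i1 s t.

Definition inv_metric (g : metric2) : metric2 := fun i j s t =>
  match i, j with
  | i1, i1 => g i2 i2 s t / det_metric g s t
  | i1, i2 => - g i1 i2 s t / det_metric g s t
  | i2, i1 => - g i2 i1 s t / det_metric g s t
  | i2, i2 => g i1 i1 s t / det_metric g s t
  end.

(* [christoffel g k i j] is Gamma^k_{ij}, the coefficient of d_k in the
   Levi-Civita derivative of d_j along d_i. *)
Definition christoffel (g : metric2) (k i j : idx) (s t : R) : R :=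
  / 2 * sum2 (fun l =>
    inv_metric g k l s t
    * (pd i (g j l) s t + pd j (g i l) s t - pd l (g i j) s t)).

(* [riemann g l k i j] is the coefficient of d_l in R(d_i, d_j) d_k, with
   R(X, Y) Z = D_X D_Y Z - D_Y D_X Z - D_[X,Y] Z. *)
Definition riemann (g : metric2) (l k i j : idx) (s t : R) : R :=
  pd i (christoffel g l j k) s t - pd j (christoffel g l i k) s t
  + sum2 (fun m => christoffel g m j k s t * christoffel g l i m s t
                   - christoffel g m i k s t * christoffel g l j m s t).

(* <R(d_1, d_2) d_2, d_1> / (|d_1|^2 |d_2|^2 - <d_1, d_2>^2); it equals 1 on
   the unit sphere. *)
Definition metric_curvature (g : metric2) (s t : R) : R :=
  sum2 (fun l => g i1 l s t * riemann g l i2 i1 i2 s t) / det_metric g s t.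

(** * Surfaces in Sol_3 *)

Definition induced_metric (psi : R -> R -> R3) : metric2 := fun i j s t =>
  sol_metric (psi s t) (surf_pd i psi s t) (surf_pd j psi s t).

Definition gauss_curvature (psi : R -> R -> R3) (s t : R) : R :=
  metric_curvature (induced_metric psi) s t.

Definition generated_surface (alpha : R -> R3) (s t : R) : R3 :=
  sol_L t (alpha s).

Definition circle (r s : R) : R3 :=
  (r * sin (s / r), - r * cos (s / r), 0).

Lemma generated_surface_circleE (r s t : R) :
  generated_surface (circle r) s t =
  (exp (- t) * r * sin (s / r), - exp t * r * cos (s / r), t).
Proof.
unfold generated_surface, sol_L, circle, px, py, pz; simpl.
f_equal; [f_equal |]; ring.
Qed.

(* Main.v *)
Require Import Defs.
From Stdlib Require Import Reals Lra.
From Coquelicot Require Import Coquelicot.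
Open Scope R_scope.

(** Writing E, F, G for the coefficients of the induced metric in the
    coordinates (s, t), one finds E = 1, F = - 2 r sin(s/r) cos(s/r) and
    G = r^2 + 1. When E and G are constant and F does not depend on t, the only
    Christoffel symbols that may be nonzero are those with lower indices (1, 1),
    so d_2 is a parallel field. Hence R(d_1, d_2) d_2 = 0 and K = 0. *)

Lemma pd_ext (i : idx) (f g : R -> R -> R) (s t : R) :
  (forall u v, f u v = g u v) -> pd i f s t = pd i g s t.
Proof. intros H; destruct i; apply Derive_ext; intros; apply H. Qed.

Lemma pd_const (i : idx) (f : R -> R -> R) (c s t : R) :
  (forall u v, f u v = c) -> pd i f s t = 0.
Proof.
intros H; rewrite (pd_ext i f (fun _ _ => c)) by exact H.
destruct i; exact (Derive_const c _).
Qed.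

Lemma pd2_fst (f : R -> R -> R) (h : R -> R) (s t : R) :
  (forall u v, f u v = h u) -> pd i2 f s t = 0.
Proof.
intros H; rewrite (pd_ext i2 f (fun u _ => h u)) by exact H.
exact (Derive_const (h s) t).
Qed.

Lemma metric_curvature_const_diag (g : metric2) (c d : R) (F : R -> R) :
  (forall s t, g i1 i1 s t = c) ->
  (forall s t, g i2 i2 s t = d) ->
  (forall s t, g i1 i2 s t = F s) ->
  (forall s t, g i2 i1 s t = F s) ->
  forall s t, metric_curvature g s t = 0.
Proof.
intros H11 H22 H12 H21.
(* In Gamma_{12} the term l = 1 of the sum contains d_1 g_21 - d_1 g_12, which cancels only by
   symmetry of the metric. *)
assert (sym : forall s t, pd i1 (g i2 i1) s t = pd i1 (g i1 i2) s t).
{ intros s t; apply pd_ext; intros u v; rewrite H12; apply H21. }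
assert (G12 : forall k s t, christoffel g k i1 i2 s t = 0).
{ intros k s t; unfold christoffel, sum2.
  rewrite sym, (pd_const i2 _ c s t H11), (pd_const i1 _ d s t H22); ring. }
assert (G21 : forall k s t, christoffel g k i2 i1 s t = 0).
{ intros k s t; unfold christoffel, sum2.
  rewrite sym, (pd_const i2 _ c s t H11), (pd_const i1 _ d s t H22),
    (pd2_fst _ F s t H12), (pd2_fst _ F s t H21); ring. }
(* Here the independence of F from t is essential: the term l = 1 contains 2 d_2 g_21. *)
assert (G22 : forall k s t, christoffel g k i2 i2 s t = 0).
{ intros k s t; unfold christoffel, sum2.
  rewrite (pd_const i1 _ d s t H22), (pd_const i2 _ d s t H22),
    (pd2_fst _ F s t H21); ring. }
(* The symbols Gamma^l_{11} enter only through the product with Gamma^1_{22} = 0. *)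
assert (Rm : forall l s t, riemann g l i2 i1 i2 s t = 0).
{ intros l s t; unfold riemann, sum2.
  rewrite (pd_const i1 _ 0 s t (G22 l)), (pd_const i2 _ 0 s t (G12 l)),
    !G12, !G22; ring. }
intros s t; unfold metric_curvature, sum2.
rewrite !Rm; unfold Rdiv; ring.
Qed.

Definition derive_closed (A : (R -> R) -> Prop) : Prop :=
  forall a, A a -> exists a', A a' /\ forall x, is_derive a x (a' x).

(** Both partial derivatives of a(s) b(t) are again such products, with a' in A or b' in B, so
    induction on the order of differentiability works once a, b and f are generalized. No formula
    for higher derivatives is required. *)
Lemma smooth2_tensor (A B : (R -> R) -> Prop) (a b : R -> R) (f : R -> R -> R) :
  derive_closed A -> derive_closed B -> A a -> B b ->
  (forall s t, f s t = a s * b t) -> smooth2 f.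
Proof.
intros HA HB Aa Bb Hf n; revert a b f Aa Bb Hf.
induction n as [|n IH]; intros a b f Aa Bb Hf s t;
  destruct (HA a Aa) as [a' [Aa' da]]; destruct (HB b Bb) as [b' [Bb' db]].
all: assert (Cf : continuity_2d_pt f s t).
(* [ex_diff_n] demands continuity at every order, so the base case and the inductive step share this
   argument. *)
1, 3: apply continuity_2d_pt_ext with (fun u v => a u * b v);
  [ intros; symmetry; apply Hf | ];
  apply continuity_2d_pt_mult;
  [ apply (continuity_1d_2d_pt_comp a (fun u _ => u));
    [ | apply continuity_2d_pt_id1 ]
  | apply (continuity_1d_2d_pt_comp b (fun _ v => v));
    [ | apply continuity_2d_pt_id2 ] ];
  apply continuity_pt_filterlim, (ex_derive_continuous (V := R_NormedModule));
  eexists; eauto.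
{ simpl; auto. }
assert (d1 : forall u v, is_derive (fun z => f z v) u (a' u * b v)).
{ intros u v; apply (is_derive_ext (fun z => a z * b v)).
  { intros; symmetry; apply Hf. }
  apply (is_derive_ext (fun z => scal (b v) (a z))).
  { intros; apply Rmult_comm. }
  rewrite Rmult_comm; apply (is_derive_scal (fun z => a z)), da. }
assert (d2 : forall u v, is_derive (fun z => f u z) v (a u * b' v)).
{ intros u v; apply (is_derive_ext (fun z => a u * b z)).
  { intros; symmetry; apply Hf. }
  apply (is_derive_scal (fun z => b z)), db. }
simpl; split; [exact Cf | split; [ | split; [ | split ]]].
- eexists; apply d1.
- eexists; apply d2.
- apply (IH a' b); auto; intros; apply is_derive_unique, d1.
- apply (IH a b'); auto; intros; apply is_derive_unique, d2.
Qed.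

(** These classes supply the factors of the three coordinates. Closure under derivation dictates
    their form: sine and cosine together, and constants among the affine functions. *)
Definition trig_fun (k : R) (a : R -> R) : Prop :=
  exists c d, forall x, a x = c * sin (k * x) + d * cos (k * x).

Definition exp_fun (k : R) (a : R -> R) : Prop :=
  exists c, forall x, a x = c * exp (k * x).

Definition affine_fun (a : R -> R) : Prop :=
  exists c d, forall x, a x = c * x + d.

Lemma trig_fun_derive_closed (k : R) : derive_closed (trig_fun k).
Proof.
intros a [c [d Ha]].
exists (fun x => - (d * k) * sin (k * x) + c * k * cos (k * x)); split.
{ now exists (- (d * k)), (c * k). }
intros x; eapply is_derive_ext; [intros; symmetry; apply Ha |].
auto_derive; [auto | ring].
Qed.

Lemma exp_fun_derive_closed (k : R) : derive_closed (exp_fun k).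
Proof.
intros a [c Ha].
exists (fun x => c * k * exp (k * x)); split; [now exists (c * k) |].
intros x; eapply is_derive_ext; [intros; symmetry; apply Ha |].
auto_derive; [auto | ring].
Qed.

Lemma affine_fun_derive_closed : derive_closed affine_fun.
Proof.
intros a [c [d Ha]].
exists (fun _ => c); split.
{ exists 0, c; intros; ring. }
intros x; eapply is_derive_ext; [intros; symmetry; apply Ha |].
auto_derive; [auto | ring].
Qed.

(** The radius cancels the factor [/ r] of the chain rule: the circle is parametrized by Euclidean
    arc length. *)
Lemma surf_pd1_circle (r s t : R) : r <> 0 ->
  surf_pd i1 (generated_surface (circle r)) s t =
  (exp (- t) * cos (s / r), exp t * sin (s / r), 0).
Proof.
intros hr; unfold surf_pd, pd, generated_surface, sol_L, circle, px, py, pz.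
simpl; f_equal; [f_equal |]; apply is_derive_unique; auto_derive; auto;
  try (unfold Rdiv; field; auto).
Qed.

Lemma surf_pd2_circle (r s t : R) :
  surf_pd i2 (generated_surface (circle r)) s t =
  (- exp (- t) * (r * sin (s / r)), - exp t * (r * cos (s / r)), 1).
Proof.
unfold surf_pd, pd, generated_surface, sol_L, circle, px, py, pz.
simpl; f_equal; [f_equal |]; apply is_derive_unique; auto_derive; auto; ring.
Qed.

Lemma smooth2_circle (r : R) :
  let psi := generated_surface (circle r) in
  smooth2 (fun s t => px (psi s t)) /\
  smooth2 (fun s t => py (psi s t)) /\
  smooth2 (fun s t => pz (psi s t)).
Proof.
unfold generated_surface, sol_L, circle, px, py, pz; simpl.
split; [ | split ].
- apply (smooth2_tensor (trig_fun (/ r)) (exp_fun (-1))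
    (fun s => r * sin (s / r)) (fun t => exp (- t))).
  + apply trig_fun_derive_closed.
  + apply exp_fun_derive_closed.
  + exists r, 0; intros x; unfold Rdiv; rewrite (Rmult_comm x); ring.
  + exists 1; intros x; replace (-1 * x) with (- x) by ring; ring.
  + intros; ring.
- apply (smooth2_tensor (trig_fun (/ r)) (exp_fun 1)
    (fun s => - r * cos (s / r)) exp).
  + apply trig_fun_derive_closed.
  + apply exp_fun_derive_closed.
  + exists 0, (- r); intros x; unfold Rdiv; rewrite (Rmult_comm x); ring.
  + exists 1; intros x; rewrite !Rmult_1_l; reflexivity.
  + intros; ring.
- apply (smooth2_tensor affine_fun affine_fun (fun _ => 1) (fun t => t)).
  + apply affine_fun_derive_closed.
  + apply affine_fun_derive_closed.
  + exists 0, 1; intros; ring.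
  + exists 1, 0; intros; ring.
  + intros; ring.
Qed.

(** Each [sol_L t] is an isometry, so the coefficients can be read off at t = 0, where the ambient
    metric is Euclidean: E = 1 by arc length, and G = x^2 + y^2 + 1 is constant on a circle centred
    at the origin. *)
Lemma induced_metric_circle (r s t : R) : r <> 0 ->
  let g := induced_metric (generated_surface (circle r)) in
  g i1 i1 s t = 1 /\
  g i2 i2 s t = r ^ 2 + 1 /\
  g i1 i2 s t = - 2 * r * sin (s / r) * cos (s / r) /\
  g i2 i1 s t = - 2 * r * sin (s / r) * cos (s / r).
Proof.
intros hr g; unfold g, induced_metric.
rewrite (surf_pd1_circle r s t hr), surf_pd2_circle.
unfold sol_metric, generated_surface, sol_L, circle, px, py, pz; simpl.
(* Splitting the exponentials makes every entry a polynomial in e, e', S, C, to be reduced by e e' =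
   1 and S^2 + C^2 = 1. *)
replace (2 * (0 + t)) with (t + t) by ring.
rewrite Ropp_plus_distr, !exp_plus.
assert (He : exp t * exp (- t) = 1).
{ rewrite <- exp_plus, Rplus_opp_r; apply exp_0. }
assert (Hsc := sin2_cos2 (s / r)); unfold Rsqr in Hsc.
set (S := sin (s / r)) in *; set (C := cos (s / r)) in *.
set (e := exp t) in *; set (e' := exp (- t)) in *.
repeat split.
- transitivity ((e * e') ^ 2 * (S * S + C * C)); [ring |].
  rewrite He, Hsc; ring.
- transitivity ((e * e') ^ 2 * r ^ 2 * (S * S + C * C) + 1); [ring |].
  rewrite He, Hsc; ring.
- transitivity (- 2 * r * S * C * (e * e') ^ 2); [ring |].
  rewrite He; ring.
- transitivity (- 2 * r * S * C * (e * e') ^ 2); [ring |].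
  rewrite He; ring.
Qed.

Theorem mainTheorem3 (r : R) (hr : 0 < r) :
  immersed_surface (generated_surface (circle r)) /\
  (forall s t : R, gauss_curvature (generated_surface (circle r)) s t = 0).
Proof.
assert (hr0 : r <> 0) by lra.
split; [split; [apply smooth2_circle |] |].
- intros s t a b.
  rewrite (surf_pd1_circle r s t hr0), surf_pd2_circle.
  unfold px, py, pz; simpl; intros Hx Hy Hz.
  (* The z-components of the two tangent vectors are 0 and 1. *)
  assert (Hb : b = 0) by lra.
  subst b; split; [ | reflexivity ].
  assert (Hc : a * cos (s / r) = 0).
  { apply (Rmult_eq_reg_l (exp (- t))); [lra |].
    apply Rgt_not_eq, exp_pos. }
  assert (Hs : a * sin (s / r) = 0).
  { apply (Rmult_eq_reg_l (exp t)); [lra |].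
    apply Rgt_not_eq, exp_pos. }
  assert (Hsc := sin2_cos2 (s / r)); unfold Rsqr in Hsc.
  (* Sine and cosine have no common zero: a = a (sin^2 + cos^2). *)
  transitivity (a * sin (s / r) * sin (s / r) + a * cos (s / r) * cos (s / r)).
  + rewrite <- (Rmult_1_r a) at 1; rewrite <- Hsc; ring.
  + rewrite Hs, Hc; ring.
- apply (metric_curvature_const_diag _ 1 (r ^ 2 + 1)
    (fun s => - 2 * r * sin (s / r) * cos (s / r)));
    intros s t; apply (induced_metric_circle r s t hr0).
Qed.
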